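(* $\operatorname{non}^*_\omega(\mathrm{Fin}\otimes\mathrm{Fin})=\mathfrak d$.
   Context: $\mathrm{Fin}\otimes\mathrm{Fin}=\{A\subseteq\omega\times\omega:\text{for all but finitely many }n,\ \{m:\langle n,m\rangle\in A\}\text{ is finite}\}$. For an ideal $\mathscr I$ on a countable set $X$, $\operatorname{non}^*_\omega(\mathscr I)=\min\{|\mathcal A|:\mathcal A\subseteq[X]^\omega,\ \forall\overline B\in[\mathscr I]^\omega\,\exists A\in\mathcal A\,\forall B\in\overline B\ |A\cap B|<\omega\}$, where $[Y]^\omega$ is the set of countably infinite subsets of $Y$. $\mathfrak d$ is the dominating number of $(\omega^\omega,\le^* )$. *)

(* Defs.v *)
From mathcomp Require Import all_boot.
From mathcomp Require Import boolp classical_sets functions cardinality.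

Set Implicit Arguments.
Unset Strict Implicit.
Unset Printing Implicit Defensive.

Local Open Scope classical_set_scope.
Local Open Scope card_scope.

(* Cardinals are represented by sets considered up to equipotence [#=].  Thus
   min {|A| : A in F} is represented by a member of F of least cardinality,
   unique up to [#=]; by [min_cardP] one exists as soon as F is nonempty. *)
Definition min_card (T : Type) (F : set (set T)) : set T :=
  xget set0 [set A | F A /\ forall B, F B -> A #<= B].

Definition countably_infinite_subsets (Y : Type) (S : set Y) : set (set Y) :=
  [set Z | Z `<=` S /\ Z #= [set: nat]].

(* The ideal I lives on the countable set X = [set: T]. *)
Definition star_omega_witness (T : countType) (I : set (set T)) :
    set (set (set T)) :=
  [set AA | AA `<=` countably_infinite_subsets [set: T] /\
    forall BB : set (set T), countably_infinite_subsets I BB ->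
      exists2 A, AA A & forall B, BB B -> finite_set (A `&` B)].

Definition non_star_omega (T : countType) (I : set (set T)) : set (set T) :=
  min_card (star_omega_witness I).

Definition fin_otimes_fin : set (set (nat * nat)) :=
  [set A | cofinite_set [set n | finite_set [set m | A (n, m)]]].

Definition le_star (f g : nat -> nat) : Prop :=
  cofinite_set [set n | f n <= g n].

Definition dominating (D : set (nat -> nat)) : Prop :=
  forall f, exists2 g, D g & le_star f g.

Definition dominating_number : set (nat -> nat) :=
  min_card [set D | dominating D].

Lemma exists_min_card (T : Type) (F : set (set T)) : F !=set0 ->
  exists A, F A /\ forall B, F B -> A #<= B.
Proof.
move=> [A0 FA0].
have [F0|F0] := pselect (F set0).
  by exists set0; split=> // B _; exact: card_ge0.
have Fn0 A : F A -> exists a, A a.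
  move=> FA; apply: contrapT => nA; apply: F0.
  suff <- : A = set0 by [].
  by apply/seteqP; split=> // x Ax; case: nA; exists x.
pose P (S : set (set T -> T)) :=
  (forall g, S g -> forall A, F A -> A (g A)) /\
  (forall g h, S g -> S h -> forall A, F A -> g A = h A -> g = h).
have [S [[S1 S2] Smax]] : exists S, P S /\ forall S', S `<` S' -> ~ P S'.
  apply: Zorn_bigcup => G GP Gtot; split.
    by move=> g [X GX Xg] A FA; have [H _] := GP _ GX; exact: (H _ Xg _ FA).
  move=> g h [X GX Xg] [Y GY Yh] A FA.
  have [XY|YX] := Gtot _ _ GX GY.
    by have [_ H] := GP _ GY; apply: H => //; exact: XY.
  by have [_ H] := GP _ GX; apply: H => //; exact: YX.
suff [A FA Asurj] : exists2 A, F A & forall a, A a -> exists2 g, S g & g A = a.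
  exists A; split=> // B FB.
  have AS : A #<= S.
    apply: (@card_le_trans _ _ _ ((fun g : set T -> T => g A) @` S)).
      by apply: subset_card_le => a /Asurj[g Sg <-]; exists g.
    exact: card_image_le.
  apply: (card_le_trans AS).
  have : (fun g : set T -> T => g B) @` S #= S.
    by apply: inj_card_eq => g h; rewrite !inE => Sg Sh /(S2 _ _ Sg Sh _ FB).
  rewrite card_eq_le => /andP[_ SB]; apply: (card_le_trans SB).
  by apply: subset_card_le => _ [g Sg <-]; exact: (S1 _ Sg _ FB).
apply: contrapT => nA.
have missed A : exists a, F A -> A a /\ forall g, S g -> g A <> a.
  have [FA|nFA] := pselect (F A); last first.
    by have [a _] := Fn0 _ FA0; exists a.
  apply: contrapT => na; apply: nA; exists A => // a Aa.
  apply: contrapT => nga; apply: na; exists a => _; split=> // g Sg gA.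
  by apply: nga; exists g.
have [g0 g0P] := choice missed.
apply: (Smax (S `|` [set g0])).
  split=> [g Sg|SS]; first by left.
  have Sg0 : S g0 by apply: SS; right.
  by have [_ H] := g0P _ FA0; exact: (H _ Sg0).
split=> [g [Sg|->] A FA|g h [Sg|->] [Sh|->] A FA //].
- exact: (S1 _ Sg _ FA).
- by have [] := g0P _ FA.
- exact: (S2 _ _ Sg Sh _ FA).
- by have [_ H] := g0P _ FA => /(H _ Sg).
- by have [_ H] := g0P _ FA => /esym/(H _ Sh).
Qed.

Lemma min_cardP (T : Type) (F : set (set T)) : F !=set0 ->
  F (min_card F) /\ forall B, F B -> min_card F #<= B.
Proof.
move=> /exists_min_card; exact: (xgetPex set0).
Qed.

(* Main.v *)
(** For the upper bound, the graphs of the members of a dominating family form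
    a witness: countably many sets of the ideal lie, up to finitely many
    columns, below countably many functions, which are all dominated by a
    single member of the family.  For the lower bound, given [f], a set almost
    disjoint from all the columns and from the region below the running maximum
    of [f] has, to the right of almost every [n], only points of height greater
    than [f n]; reading off the height of one such point dominates [f]. *)

Require Import Defs.
From mathcomp Require Import all_boot.
From mathcomp Require Import boolp classical_sets functions cardinality.

Local Open Scope card_scope.

Set Implicit Arguments.
Unset Strict Implicit.
Unset Printing Implicit Defensive.

Local Open Scope classical_set_scope.

Lemma finite_set_natP (A : set nat) :
  finite_set A <-> exists N, forall n, A n -> n < N.
Proof.
split=> [/finite_seqP[s ->]|[N AN]]; last exact: sub_finite_set (finite_II N).
by exists (\max_(i <- s) i).+1 => n /= ns; rewrite ltnS; exact: leq_bigmax_seq.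
Qed.

Lemma cofinite_set_natP (A : set nat) :
  cofinite_set A <-> exists N, forall n, N <= n -> A n.
Proof.
split=> [/finite_set_natP|] [N AN]; last first.
  apply/finite_set_natP; exists N => n nAn; rewrite ltnNge.
  by apply/negP => /AN.
by exists N => n Nn; apply: contrapT => /AN; rewrite ltnNge Nn.
Qed.

Lemma fin_otimes_finP (B : set (nat * nat)) :
  fin_otimes_fin B <->
  exists (f : nat -> nat) N, forall n m, N <= n -> B (n, m) -> m < f n.
Proof.
split=> [/cofinite_set_natP[N BN]|[f [N BfN]]]; last first.
  apply/cofinite_set_natP; exists N => n Nn.
  by apply/finite_set_natP; exists (f n) => m /(BfN _ _ Nn).
have /choice[f fP] n : exists b, N <= n -> forall m, B (n, m) -> m < b.
  have [Nn|nN] := leqP N n; last by exists 0.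
  by have /finite_set_natP[b bP] := BN _ Nn; exists b.
by exists f, N => n m Nn; exact: fP.
Qed.

(** Diagonal argument: the maximum of [f 0 n], ..., [f n n] is at least [f k n] as soon as [k <= n],
    so a function dominating it dominates every [f k]. *)
Lemma dominating_seq (D : set (nat -> nat)) (f : nat -> nat -> nat) :
  dominating D -> exists2 g, D g & forall k, le_star (f k) g.
Proof.
move=> /(_ (fun n => \max_(k < n.+1) f k n))[g Dg /cofinite_set_natP[N fg]].
exists g => // k; apply/cofinite_set_natP; exists (maxn N k) => n.
rewrite geq_max => /andP[/fg/= + kn]; apply: leq_trans.
have kn1 : k < n.+1 by [].
exact: (leq_bigmax (Ordinal kn1)).
Qed.

Definition graph (g : nat -> nat) : set (nat * nat) :=
  range (fun n => (n, g n)).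

Lemma dominating_graph_witness (D : set (nat -> nat)) :
  dominating D -> star_omega_witness fin_otimes_fin (graph @` D).
Proof.
move=> domD; split=> [_ [g Dg <-]|BB [BBI /card_esym cardBB]].
  by split=> //; apply: inj_card_eq => n m _ _ [].
have /pcard_surjP[e esurj] : BB #<= [set: nat].
  by move: cardBB; rewrite card_eq_le => /andP[].
(* The surjection [e] may also take values outside [BB]; this is why the bound is guarded, with [id]
   as filler. *)
have /choice[f fP] k : exists f : nat -> nat, BB (e k) ->
    exists N, forall n m, N <= n -> e k (n, m) -> m < f n.
  have [BBk|nBBk] := pselect (BB (e k)); last by exists id.
  by have /fin_otimes_finP[f fP] := BBI _ BBk; exists f.
have [g Dg fg] := dominating_seq f domD.
exists (graph g); first by exists g.
move=> B BBB; have [k _ ek] := esurj _ BBB; subst B.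
have [N BN] := fP _ BBB.
have /cofinite_set_natP[M fgM] := fg k.
apply: (sub_finite_set _ (finite_image (fun n => (n, g n))
  (finite_II (maxn N M)))).
move=> _ [[n _ <-] Bn]; exists n => //=; rewrite ltnNge geq_max.
apply/negP => /andP[Nn /fgM/= fgn].
by have := BN _ _ Nn Bn; rewrite ltnNge fgn.
Qed.

Definition height_after (A : set (nat * nat)) (n : nat) : nat :=
  (xget (0, 0) [set p | A p /\ n <= p.1]).2.

Lemma witness_height_after_dominating (AA : set (set (nat * nat))) :
  star_omega_witness fin_otimes_fin AA -> dominating (height_after @` AA).
Proof.
move=> [AAinf AAwit] f.
(* The point read off by [height_after] may lie far to the right of [n]; monotonicity of [F] still
   bounds [f n] there. *)
pose F n := \max_(i < n.+1) f i.
have fF n m : n <= m -> f n <= F m.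
  by rewrite -ltnS => nm; exact: (leq_bigmax (Ordinal nm)).
pose B k : set (nat * nat) := [set p | p.1 <= k \/ p.2 <= F p.1].
have BI k : fin_otimes_fin (B k).
  apply/fin_otimes_finP; exists (fun n => (F n).+1), k.+1 => n m kn [/=|//].
  by rewrite leqNgt kn.
(* The point [(k, (F k).+1)] lies above the region under [F], so only the column clause can put it
   in [B l]. Hence the [B k] are distinct and form an infinite family. *)
have Bsub k l : B k `<=` B l -> k <= l.
  by move=> /(_ (k, (F k).+1)) []; [left | | rewrite /= ltnn].
have cardB : range B #= [set: nat].
  apply: inj_card_eq => k l _ _ kl; apply/eqP.
  by rewrite eqn_leq !Bsub ?kl.
have [|A AAA AB] := AAwit (range B).
  by split=> // _ [k _ <-]; exact: BI.
have Ainf : infinite_set A.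
  have [_] := AAinf _ AAA; rewrite card_eq_le => /andP[_].
  by rewrite -infiniteP.
exists (height_after A); first by exists A.
have /finite_set_natP[N AN] : finite_set (fst @` (A `&` B 0)).
  by apply/finite_image/AB; exists 0.
apply/cofinite_set_natP; exists N => n Nn /=.
rewrite /height_after; case: xgetP => [p _ [Ap np]|noA]; last first.
  (* Without a point in column [n] or beyond, [A] would lie inside [B n] and so be finite; the
     default [(0, 0)] is thus never read. *)
  exfalso; apply: Ainf; apply: (sub_finite_set _ (AB (B n) _)); last by exists n.
  move=> p Ap; split=> //; left; rewrite leqNgt; apply/negP => /ltnW np.
  exact: (noA p).
apply: leq_trans (fF _ _ np) _; rewrite leqNgt; apply/negP => /ltnW pF.
have /AN : (fst @` (A `&` B 0)) p.1 by exists p => //; split=> //; right.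
by rewrite ltnNge (leq_trans Nn).
Qed.

Theorem proposition3p25 : non_star_omega fin_otimes_fin #= dominating_number.
Proof.
(* The family of all functions, and its graphs, show that both minima are attained. *)
have domT : dominating [set: nat -> nat].
  by move=> f; exists f => //; apply/cofinite_set_natP; exists 0 => n _ /=.
have [domD minD] := min_cardP (ex_intro [set D | dominating D] _ domT).
have [witA minA] := min_cardP (ex_intro _ _ (dominating_graph_witness domT)).
rewrite card_eq_le; apply/andP; split.
- by apply: card_le_trans (minA _ (dominating_graph_witness domD)) _;
    exact: card_image_le.
- by apply: card_le_trans (minD _ (witness_height_after_dominating witA)) _;
    exact: card_image_le.
Qed.
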